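(* Let $G$ be a connected graph with $n\ge 2$ vertices and $m$ edges, and let $D\in\{-1,0,1\}^{m\times n}$ be its incidence matrix. Let $\theta^*\in\mathbb{R}^n$, $\sigma>0$ and $y=\theta^*+\varepsilon$ with $\varepsilon\sim\mathcal N(0,\sigma^2 I_n)$. Fix $\delta\in(0,1)$ and $T\subseteq[m]$, and define $$\lambda:=\frac1n\,\sigma\rho\sqrt{2\log\Big(\frac{em}{\delta}\Big)},$$ where $\rho=\rho(D)$ is the inverse scaling factor of $D$. Let $\hat\theta$ be the TV denoiser, i.e. any solution of $$\hat\theta\in\operatorname*{argmin}_{\theta\in\mathbb{R}^n}\ \frac1{2n}\|\theta-y\|_2^2+\lambda\|D\theta\|_1 .$$ Then, with probability at least $1-2\delta$, $$\frac1n\|\hat\theta-\theta^*\|_2^2\le\inf_{\bar\theta\in\mathbb{R}^n}\Big\{\frac1n\|\bar\theta-\theta^*\|_2^2+4\lambda\|(D\bar\theta)_{T^c}\|_1\Big\}+\frac{8\sigma^2}{n}\left(\frac{|T|\rho^2}{\kappa_T^2}\log\Big(\frac{em}{\delta}\Big)+\log\Big(\frac e\delta\Big)\right),$$ where $\kappa_T=\kappa_T(D)$ is the compatibility factor of $D$ for $T$.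
   Context: For an undirected simple graph $G=(V,E)$ with $V$ identified with $[n]=\{1,\dots,n\}$ and $E$ identified with $[m]$, the (edge-vertex) incidence matrix $D\in\{-1,0,1\}^{m\times n}$ has, for the row indexed by the edge $e=(i,j)$, entries $D_{e,k}=1$ if $k=\min(i,j)$, $D_{e,k}=-1$ if $k=\max(i,j)$, and $D_{e,k}=0$ otherwise. For $x\in\mathbb{R}^m$ and $T\subseteq[m]$, $x_T\in\mathbb{R}^m$ denotes the vector with $(x_T)_j=x_j$ if $j\in T$ and $0$ otherwise; $T^c=[m]\setminus T$. Compatibility factor: $\kappa_\emptyset:=1$ and, for $T\ne\emptyset$, $\kappa_T=\kappa_T(D):=\inf_{\theta\in\mathbb{R}^n}\frac{\sqrt{|T|}\,\|\theta\|_2}{\|(D\theta)_T\|_1}$ (infimum over $\theta$ with $(D\theta)_T\neq0$). Inverse scaling factor: let $D^\dagger=[s_1,\dots,s_m]$ be the Moore–Penrose pseudoinverse of $D$ with columns $s_j$; then $\rho=\rho(D):=\max_{j\in[m]}\|s_j\|_2$. *)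

(* Defs.v *)
From HB Require Import structures.
From mathcomp Require Import all_boot all_order all_algebra.
From mathcomp Require Import all_classical all_reals all_analysis.

Set Implicit Arguments.
Unset Strict Implicit.
Unset Printing Implicit Defensive.
Import Order.TTheory GRing.Theory Num.Theory.
Import numFieldNormedType.Exports.

Local Open Scope classical_set_scope.
Local Open Scope ring_scope.

(* The library norm on matrices is the sup norm, hence the definitions below. *)
Definition l2norm (R : realType) (k : nat) (x : 'cV[R]_k) : R :=
  Num.sqrt (\sum_(i < k) x i 0 ^+ 2).

Definition l1norm (R : realType) (k : nat) (x : 'cV[R]_k) : R :=
  \sum_(i < k) `|x i 0|.

Definition restr (R : realType) (m : nat) (T : {set 'I_m}) (x : 'cV[R]_m)
    : 'cV[R]_m :=
  \col_j (if j \in T then x j 0 else 0).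

(* An arbitrary identification of 'I_m with the set of undirected edges of the
   adjacency relation g; the two endpoints may be listed in either order. *)
Definition edge_labelling (n m : nat) (g : rel 'I_n)
    (ed : 'I_m -> 'I_n * 'I_n) : Prop :=
  (forall e, g (ed e).1 (ed e).2) /\
  (forall i j, g i j -> exists! e, ed e = (i, j) \/ ed e = (j, i)).

Definition incidence (R : realType) (n m : nat) (ed : 'I_m -> 'I_n * 'I_n)
    : 'M[R]_(m, n) :=
  \matrix_(e, k)
    (if k == minn (ed e).1 (ed e).2 :> nat then 1
     else if k == maxn (ed e).1 (ed e).2 :> nat then -1 else 0).

Definition moore_penrose (R : realType) (m n : nat) (A : 'M[R]_(m, n))
    (B : 'M[R]_(n, m)) : Prop :=
  [/\ A *m B *m A = A, B *m A *m B = B,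
      (A *m B)^T = A *m B & (B *m A)^T = B *m A].

(* The library's pinvmx is only a one-sided partial inverse, in general not the
   Moore-Penrose pseudoinverse. *)
Definition mpinv (R : realType) (m n : nat) (A : 'M[R]_(m, n))
    : 'M[R]_(n, m) :=
  xget 0 [set B | moore_penrose A B].

Lemma moore_penrose_unique (R : realType) (m n : nat) (A : 'M[R]_(m, n))
    (B C : 'M[R]_(n, m)) :
  moore_penrose A B -> moore_penrose A C -> B = C.
Proof.
move=> [ABA BAB sAB sBA] [ACA CAC sAC sCA].
have AB_AC : A *m B = A *m C.
  have -> : A *m B = A *m C *m (A *m B) by rewrite mulmxA ACA.
  by rewrite -sAB -sAC -trmx_mul mulmxA ABA.
have BA_CA : B *m A = C *m A.
  have -> : B *m A = B *m A *m (C *m A) by rewrite -mulmxA (mulmxA A) ACA.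
  by rewrite -sBA -sCA -trmx_mul -mulmxA (mulmxA A) ABA.
by rewrite -BAB -CAC BA_CA -!mulmxA AB_AC.
Qed.

Lemma mulmx_trmx_unit (R : realType) (r n : nat) (F : 'M[R]_(r, n)) :
  row_free F -> F *m F^T \in unitmx.
Proof.
move=> Ffree; rewrite -row_free_unit -kermx_eq0; apply/eqP/row_matrixP => i.
rewrite row0; set u := row i _.
have uFF : u *m (F *m F^T) = 0 by apply/sub_kermxP; exact: row_sub.
apply: (row_free_inj Ffree); rewrite mul0mx; apply/rowP => j; rewrite [RHS]mxE.
have : (u *m F *m (u *m F)^T) 0 0 = 0.
  by rewrite trmx_mul mulmxA -[u *m F *m F^T]mulmxA uFF mul0mx mxE.
rewrite mxE => /eqP; rewrite psumr_eq0 => [/allP/(_ j)|k _].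
  by rewrite mem_index_enum => /(_ isT) /=; rewrite [_^T _ _]mxE -expr2 sqrf_eq0 => /eqP.
by rewrite [_^T _ _]mxE -expr2 sqr_ge0.
Qed.

Lemma moore_penrose_exists (R : realType) (m n : nat) (A : 'M[R]_(m, n)) :
  exists B, moore_penrose A B.
Proof.
have [r [C [F [AE Ffree Cfree]]]] : exists r (C : 'M[R]_(m, r))
    (F : 'M[R]_(r, n)), [/\ A = C *m F, row_free F & row_free C^T].
  exists (\rank A), (col_base A), (row_base A).
  split; [by rewrite mulmx_base | exact: row_base_free |].
  by rewrite /row_free mxrank_tr; exact: col_base_full.
pose U := F *m F^T; pose V := C^T *m C.
have uU : U \in unitmx by exact: mulmx_trmx_unit.
have uV : V \in unitmx.
  by have := mulmx_trmx_unit Cfree; rewrite trmxK.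
have sU : U^T = U by rewrite trmx_mul trmxK.
have sV : V^T = V by rewrite trmx_mul trmxK.
exists (F^T *m invmx U *m invmx V *m C^T).
have AB : A *m (F^T *m invmx U *m invmx V *m C^T) = C *m invmx V *m C^T.
  by rewrite AE !mulmxA -(mulmxA C F) -/U -(mulmxA C U) mulmxV// mulmx1.
have BA : F^T *m invmx U *m invmx V *m C^T *m A = F^T *m invmx U *m F.
  by rewrite AE !mulmxA -(mulmxA _ C^T C) -/V -(mulmxA _ _ V) mulVmx// mulmx1.
split.
- by rewrite AB AE !mulmxA -(mulmxA _ C^T C) -/V -(mulmxA _ _ V) mulVmx// mulmx1.
- rewrite BA !mulmxA -(mulmxA _ F F^T) -/U -(mulmxA _ _ U) mulVmx// mulmx1.
  by [].
- by rewrite AB !trmx_mul trmxK trmx_inv sV mulmxA.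
- by rewrite BA !trmx_mul trmxK trmx_inv sU mulmxA.
Qed.

Lemma mpinvP (R : realType) (m n : nat) (A : 'M[R]_(m, n)) :
  moore_penrose A (mpinv A).
Proof.
by have [B AB] := moore_penrose_exists A; exact: (@xgetPex _ 0
  [set B | moore_penrose A B] (ex_intro _ B AB)).
Qed.

(* The entries of the maximum are nonnegative, so the base value 0 is harmless. *)
Definition inverse_scaling (R : realType) (m n : nat) (D : 'M[R]_(m, n)) : R :=
  \big[Num.max/0]_(j < m) l2norm (col j (mpinv D)).

Definition compatibility (R : realType) (m n : nat) (D : 'M[R]_(m, n))
    (T : {set 'I_m}) : R :=
  if T == finset.set0 then 1
  else inf [set Num.sqrt #|T|%:R * l2norm theta / l1norm (restr T (D *m theta))
           | theta in [set theta : 'cV[R]_n | restr T (D *m theta) != 0]].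

Definition tv_objective (R : realType) (m n : nat) (D : 'M[R]_(m, n))
    (lambda : R) (y theta : 'cV[R]_n) : R :=
  (2 * n%:R)^-1 * l2norm (theta - y) ^+ 2 + lambda * l1norm (D *m theta).

Definition tv_denoiser (R : realType) (m n : nat) (D : 'M[R]_(m, n))
    (lambda : R) (y thetahat : 'cV[R]_n) : Prop :=
  forall theta, tv_objective D lambda y thetahat <= tv_objective D lambda y theta.

Definition mutually_independent (R : realType) (d : measure_display)
    (Omega : measurableType d) (P : probability Omega R) (n : nat)
    (X : 'I_n -> {RV P >-> R}) : Prop :=
  forall (J : {set 'I_n}) (B : 'I_n -> set R),
    (forall i, measurable (B i)) ->
    P [set w | forall i, i \in J -> B i (X i w)] =
    (\prod_(i in J) P (X i @^-1` B i))%E.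

(* The law N(0, sigma^2 I_n) of the vector (X_1, ..., X_n); the library's
   normal_prob takes the standard deviation as its second argument. *)
Definition gaussian_noise (R : realType) (d : measure_display)
    (Omega : measurableType d) (P : probability Omega R) (n : nat) (sigma : R)
    (X : 'I_n -> {RV P >-> R}) : Prop :=
  mutually_independent X /\
  (forall i (B : set R), measurable B ->
     distribution P (X i) B = normal_prob 0 sigma B).

(* Agrees with p <= P E when E is measurable, and still makes sense when no
   measurability of E is known. *)
Definition with_prob_ge (R : realType) (d : measure_display)
    (Omega : measurableType d) (P : probability Omega R) (p : R)
    (E : set Omega) : Prop :=
  exists A : set Omega, [/\ measurable A, A `<=` E & (p%:E <= P A)%E].

(* Main.v *)
Require Import Defs.
From HB Require Import structures.
From mathcomp Require Import all_boot all_order all_algebra.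
From mathcomp Require Import all_classical all_reals all_analysis.
From mathcomp Require Import measurable_realfun.
From mathcomp Require Import ring lra.
Set Implicit Arguments.
Unset Strict Implicit.
Unset Printing Implicit Defensive.
Import Order.TTheory GRing.Theory Num.Theory.
Import numFieldNormedType.Exports.
Local Open Scope classical_set_scope.
Local Open Scope ring_scope.

(** The estimator is compared with an arbitrary competitor theta through the
    error v = thetahat - theta.  First-order optimality of thetahat bounds the
    quadratic loss by the noise term <eps, v> plus a difference of total
    variations ([tv_first_order]).  Let B be the Moore-Penrose inverse of D.
    Then B D is the orthogonal projection onto the orthogonal complement of
    ker D, and v = p + q with p in ker D and q = B D v.  The noise term splits
    accordingly.

    - On the range part, <eps, q> = <B^T eps, D v>, which is at most
      (max_j |<s_j, eps>|) ||D v||_1.  The tuning of lambda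
      makes the maximum at most n lambda, so this term can be merged with the
      total variations; what survives is 4 lambda ||(D v)_T||_1 and
      4 lambda ||(D theta)_{T^c}||_1 ([l1norm_decomposability]).
    - On the kernel part, <eps, p> is at most half of ||p||^2 plus half of the
      squared norm of the projection of eps onto ker D.

    Since D v = D q, the compatibility factor bounds ||(D v)_T||_1 by ||q||
    alone, so the first remainder is absorbed by ||q||^2.  The two completions
    of squares thus use up orthogonal pieces of ||v||^2 and do not compete;
    spending ||v||^2 on both at once would cost a factor 2 in front of the
    compatibility term, which the claimed constant 8 does not allow.  This is
    [tv_oracle_inequality], a deterministic statement.

    It remains to control the two noise quantities.  Both are linear
    combinations of independent centred Gaussian variables: <s_j, eps> with
    ||s_j|| <= rho, and, because connectivity reduces ker D to the constant
    vectors, (sum_i eps_i) / sqrt n.  A Chernoff bound gives each the tail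
    2 exp (- u) beyond sqrt (2 u) standard deviations ([gaussian_lincomb_tail]),
    and the union bound over the m + 1 events costs
    2 delta / e + 2 delta / e <= 2 delta.

    Independence is known only for events.  It is transferred to expectations
    of products by replacing the indicator functions with general nonnegative
    functions one variable at a time ([independent_integral_prod]): a nonnegative
    function may be integrated against two weighted image measures
    interchangeably as soon as these agree on measurable sets
    ([weighted_integral_eq]).  The same principle computes the Gaussian
    moment generating function from the density. *)

(** * Euclidean and l1 geometry of column vectors *)

Section Vectors.
Context {R : realType}.

Definition dotv (k : nat) (u v : 'cV[R]_k) : R := (u^T *m v) 0 0.

Lemma dotvE k (u v : 'cV[R]_k) : dotv u v = \sum_i u i 0 * v i 0.
Proof. by rewrite /dotv mxE; apply: eq_bigr => i _; rewrite mxE. Qed.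

Lemma dotvC k (u v : 'cV[R]_k) : dotv u v = dotv v u.
Proof. by rewrite !dotvE; apply: eq_bigr => i _; rewrite mulrC. Qed.

Lemma dotvDr k (u v w : 'cV[R]_k) : dotv u (v + w) = dotv u v + dotv u w.
Proof. by rewrite /dotv mulmxDr mxE. Qed.

Lemma dotvNr k (u v : 'cV[R]_k) : dotv u (- v) = - dotv u v.
Proof. by rewrite /dotv mulmxN mxE. Qed.

Lemma dotvZr k a (u v : 'cV[R]_k) : dotv u (a *: v) = a * dotv u v.
Proof. by rewrite /dotv -scalemxAr mxE. Qed.

Lemma dotvDl k (u v w : 'cV[R]_k) : dotv (v + w) u = dotv v u + dotv w u.
Proof. by rewrite dotvC dotvDr !(dotvC u). Qed.

Lemma dotvNl k (u v : 'cV[R]_k) : dotv (- v) u = - dotv v u.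
Proof. by rewrite dotvC dotvNr (dotvC u). Qed.

Lemma dotvZl k a (u v : 'cV[R]_k) : dotv (a *: v) u = a * dotv v u.
Proof. by rewrite dotvC dotvZr (dotvC u). Qed.

Lemma dotv_mulmxr k l (A : 'M[R]_(k, l)) u v :
  dotv u (A *m v) = dotv (A^T *m u) v.
Proof. by rewrite /dotv trmx_mul trmxK mulmxA. Qed.

Lemma dotv_ge0 k (u : 'cV[R]_k) : 0 <= dotv u u.
Proof. by rewrite dotvE; apply: sumr_ge0 => i _; rewrite -expr2 sqr_ge0. Qed.

Lemma l2norm_sq k (u : 'cV[R]_k) : l2norm u ^+ 2 = dotv u u.
Proof.
rewrite /l2norm sqr_sqrtr; last by apply: sumr_ge0 => i _; exact: sqr_ge0.
by rewrite dotvE; under eq_bigr do rewrite expr2.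
Qed.

Lemma l2norm_ge0 k (u : 'cV[R]_k) : 0 <= l2norm u.
Proof. exact: sqrtr_ge0. Qed.

Lemma coord_le_l2norm k (u : 'cV[R]_k) i : `|u i 0| <= l2norm u.
Proof.
rewrite -(ler_pXn2r (ltn0Sn 1)) ?nnegrE ?l2norm_ge0// l2norm_sq dotvE.
rewrite real_normK ?num_real// (bigD1 i)//= -expr2 lerDl.
by apply: sumr_ge0 => j _; rewrite -expr2 sqr_ge0.
Qed.

Lemma l1norm_ge0 k (u : 'cV[R]_k) : 0 <= l1norm u.
Proof. exact: sumr_ge0. Qed.

Lemma ler_l1normD k (u v : 'cV[R]_k) : l1norm (u + v) <= l1norm u + l1norm v.
Proof.
rewrite /l1norm -big_split/=; apply: ler_sum => i _.
by rewrite mxE ler_normD.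
Qed.

Lemma l1normZ k a (u : 'cV[R]_k) : l1norm (a *: u) = `|a| * l1norm u.
Proof. by rewrite /l1norm mulr_sumr; apply: eq_bigr => i _; rewrite mxE normrM. Qed.

Lemma dotv_le_l1norm k (u v : 'cV[R]_k) M :
  (forall i, `|u i 0| <= M) -> dotv u v <= M * l1norm v.
Proof.
move=> uM; rewrite dotvE /l1norm mulr_sumr; apply: ler_sum => i _.
by rewrite (le_trans (ler_norm _))// normrM ler_wpM2r.
Qed.

(** Coordinatewise triangle inequalities: |a| >= |b| - |a - b| on T, where the
    error is kept, and |a - b| <= |a| + |b| off T, where the competitor is. *)
Lemma l1norm_decomposability m (T : {set 'I_m}) (u v : 'cV[R]_m) :
  l1norm (u - v) + l1norm v - l1norm u <=
  2 * l1norm (restr T (u - v)) + 2 * l1norm (restr (~: T) v).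
Proof.
rewrite /l1norm !mulr_sumr -!big_split -sumrB /=; apply: ler_sum => j _.
rewrite !mxE inE; case: (j \in T) => /=; rewrite normr0 mulr0 ?addr0 ?add0r.
  by have := lerB_dist (v j 0) (u j 0); rewrite (distrC (v j 0)); lra.
by have := ler_normB (u j 0) (v j 0); lra.
Qed.

(** Any finite constant serves: it shows that the infimum defining the
    compatibility factor is positive, hence that dividing by the factor is
    meaningful. *)
Lemma restr_mulmx_bound m n (D : 'M[R]_(m, n)) (T : {set 'I_m}) :
  exists2 C, 0 < C & forall v, l1norm (restr T (D *m v)) <= C * l2norm v.
Proof.
exists (1 + \sum_e \sum_k `|D e k|).
  by rewrite ltr_pwDl// sumr_ge0// => e _; rewrite sumr_ge0.
move=> v; rewrite mulrDl mul1r; apply: ler_wpDl; first exact: l2norm_ge0.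
rewrite /l1norm mulr_suml; apply: ler_sum => e _; rewrite mxE.
case: ifP => _; last first.
  by rewrite normr0 mulr_ge0 ?l2norm_ge0// sumr_ge0.
rewrite mxE (le_trans (ler_norm_sum _ _ _))// mulr_suml; apply: ler_sum => k _.
by rewrite normrM ler_wpM2l// coord_le_l2norm.
Qed.

(** The infimum ranges over the vectors with [restr T (D *m v)] nonzero only, and
    [inf] of an empty set is 0; the remaining vectors satisfy the bound
    trivially. *)
Lemma compatibility_bound m n (D : 'M[R]_(m, n)) (T : {set 'I_m}) v :
  l1norm (restr T (D *m v)) <= Num.sqrt #|T|%:R / compatibility D T * l2norm v.
Proof.
rewrite /compatibility; case: eqVneq => [->|T0].
  rewrite /l1norm big1 => [|j _]; last by rewrite mxE inE normr0.
  by rewrite cards0 sqrtr0 mul0r mul0r.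
have [->|Dv0] := eqVneq (restr T (D *m v)) 0.
  rewrite [leLHS]big1 => [|j _]; last by rewrite mxE normr0.
  rewrite mulr_ge0 ?l2norm_ge0// divr_ge0// ?sqrtr_ge0//.
  set S := [set _ | _ in _]; have [->|/set0P S0] := eqVneq S set0.
    by rewrite inf0.
  apply: lb_le_inf => // _ [t _ <-].
  by rewrite divr_ge0 ?mulr_ge0 ?sqrtr_ge0 ?l1norm_ge0 ?l2norm_ge0.
set S := [set _ | _ in _].
have l1_gt0 w : restr T (D *m w) != 0 -> 0 < l1norm (restr T (D *m w)).
  move=> w0; rewrite lt_neqAle l1norm_ge0 andbT eq_sym; apply: contra w0.
  rewrite psumr_eq0// => /allP w0; apply/eqP/colP => j; rewrite [RHS]mxE.
  by have := w0 j (mem_index_enum _); rewrite /= normr_eq0 => /eqP.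
have sT : 0 < Num.sqrt #|T|%:R :> R by rewrite sqrtr_gt0 ltr0n card_gt0.
have [C C0 hC] := restr_mulmx_bound D T.
have lbS : lbound S (Num.sqrt #|T|%:R / C).
  move=> _ [w w0 <-]; rewrite -mulrA ler_pM2l// ler_pdivlMr ?l1_gt0//.
  by rewrite ler_pdivrMl.
have infS : 0 < inf S.
  apply: lt_le_trans (_ : Num.sqrt #|T|%:R / C <= _); first by rewrite divr_gt0.
  by apply: lb_le_inf => //; eexists; exists v.
have : inf S <= Num.sqrt #|T|%:R * l2norm v / l1norm (restr T (D *m v)).
  by apply: ge_inf; [exists (Num.sqrt #|T|%:R / C)|exists v].
by rewrite ler_pdivlMr ?l1_gt0// mulrAC ler_pdivlMr// mulrC.
Qed.

(** Move from [th] towards [theta] by a small step t.  The l1 part of the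
    objective is convex and the quadratic part has an error of order t ^ 2, so
    that the first-order term cannot be negative. *)
Lemma tv_first_order m n (D : 'M[R]_(m, n)) lambda (y th theta : 'cV[R]_n) :
  (0 < n)%N -> 0 <= lambda -> tv_denoiser D lambda y th ->
  dotv (th - y) (th - theta) <=
    n%:R * lambda * (l1norm (D *m theta) - l1norm (D *m th)).
Proof.
move=> n0 lambda0 hth; rewrite -subr_ge0.
set Lt := l1norm (D *m theta); set Lh := l1norm (D *m th).
set a := dotv _ _; pose E := dotv (theta - th) (theta - th).
set c := (_ - a).
have nR : 0 < n%:R :> R by rewrite ltr0n.
have step t : 0 < t <= 1 -> 0 <= 2 * c + t * E.
  move=> /andP[t0 t1]; have t0' := ltW t0.
  have t1' : 0 <= 1 - t by rewrite subr_ge0.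
  have := hth (th + t *: (theta - th)); rewrite /tv_objective !l2norm_sq.
  have -> : th + t *: (theta - th) - y = (th - y) + t *: (theta - th).
    by rewrite addrAC.
  have -> : D *m (th + t *: (theta - th)) =
            (1 - t) *: (D *m th) + t *: (D *m theta).
    rewrite mulmxDr -scalemxAr mulmxBr scalerBr scalerBl scale1r.
    by rewrite addrA addrAC.
  have := ler_l1normD ((1 - t) *: (D *m th)) (t *: (D *m theta)).
  rewrite !l1normZ !ger0_norm// -/Lt -/Lh.
  set Ln := l1norm _ => /(ler_wpM2l lambda0) hL.
  have -> : dotv (th - y + t *: (theta - th)) (th - y + t *: (theta - th)) =
      dotv (th - y) (th - y) + (t * (- a - a) + t ^+ 2 * E).
    have -> : - a = dotv (th - y) (theta - th) by rewrite /a -dotvNr opprB.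
    rewrite /E; move: (th - y) (theta - th) => u w.
    by rewrite !(dotvDl, dotvDr, dotvZl, dotvZr) (dotvC w u); ring.
  set Q := dotv _ _ => obj.
  have : 0 <= (2 * n%:R)^-1 * (t * (- a - a) + t ^+ 2 * E) + lambda * t * (Lt - Lh).
    move: obj hL.
    rewrite mulrDr; lra.
  rewrite (_ : _ + _ = (2 * n%:R)^-1 * t * (2 * c + t * E)); last first.
    by rewrite /c; field; rewrite gt_eqF.
  by rewrite pmulr_rge0// mulr_gt0// invr_gt0 mulr_gt0.
rewrite leNgt; apply/negP => c0.
have E0 : 0 <= E by exact: dotv_ge0.
have Ec : 0 < E - 2 * c by lra.
(* At this t the quadratic term equals - 2 c + 2 c t, which leaves 2 c t < 0. *)
have [t t0 tE] : exists2 t, 0 < t & t * (E - 2 * c) = - (2 * c).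
  exists (- (2 * c) / (E - 2 * c)); last by rewrite divfK// gt_eqF.
  by rewrite divr_gt0//; lra.
have t1 : t <= 1 by rewrite -(ler_pM2r Ec) tE; lra.
have := step t; rewrite t0 t1 => /(_ isT).
have : t * c < 0 by rewrite pmulr_rlt0.
by move: tE; rewrite mulrBr mulrCA; lra.
Qed.

(** The deterministic core.  [nu] bounds the energy of the noise in ker D, and
    [K] stands for sqrt |T| / kappa_T.  Writing the error as p + q with p in
    ker D and q orthogonal to it, the kernel noise is charged to ||p||^2 and
    the l1 remainder on T to ||q||^2. *)
Lemma tv_oracle_inequality m n (D : 'M[R]_(m, n)) (B : 'M[R]_(n, m))
    (lambda K nu : R) (T : {set 'I_m}) (thetastar e th theta : 'cV[R]_n) :
  (0 < n)%N -> 0 <= lambda -> moore_penrose D B ->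
  (forall v, l1norm (restr T (D *m v)) <= K * l2norm v) ->
  (forall j, `|dotv (col j B) e| <= n%:R * lambda) ->
  dotv e ((1%:M - B *m D) *m e) <= nu ->
  tv_denoiser D lambda (thetastar + e) th ->
  n%:R^-1 * l2norm (th - thetastar) ^+ 2 <=
    n%:R^-1 * l2norm (theta - thetastar) ^+ 2
    + 4 * lambda * l1norm (restr (~: T) (D *m theta))
    + (nu / n%:R + 4 * n%:R * lambda ^+ 2 * K ^+ 2).
Proof.
move=> n0 lambda0 [DBD BDB _ BDsym] hK hB hA hth.
have nR : 0 < n%:R :> R by rewrite ltr0n.
have [v thv] : exists v, th - theta = v by eexists.
pose p := (1%:M - B *m D) *m v.
pose q := B *m D *m v.
have vE : v = p + q by rewrite /p /q mulmxBl mul1mx subrK.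
have BDidem : B *m D *m (B *m D) = B *m D by rewrite mulmxA BDB.
have pq : dotv p q = 0.
  rewrite /q dotv_mulmxr BDsym /p mulmxA mulmxBr mulmx1 BDidem subrr mul0mx.
  by rewrite dotvC /dotv mulmx0 mxE.
have vv : dotv v v = dotv p p + dotv q q.
  by rewrite vE !(dotvDl, dotvDr) (dotvC q p) pq; ring.
have Dq : D *m q = D *m v by rewrite /q !mulmxA DBD.
have ep : dotv e p <= (nu + dotv p p) / 2.
  pose z := (1%:M - B *m D) *m e.
  have PiT : (1%:M - B *m D)^T = 1%:M - B *m D.
    by rewrite linearB/= trmx1 BDsym.
  have Pi2 : (1%:M - B *m D) *m (1%:M - B *m D) = 1%:M - B *m D.
    by rewrite mulmxBr mulmx1 mulmxBl mul1mx BDidem subrr subr0.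
  have -> : dotv e p = dotv z p.
    by rewrite /p -[in LHS]Pi2 -mulmxA dotv_mulmxr PiT.
  have zz : dotv z z <= nu.
    by rewrite {2}/z dotv_mulmxr PiT /z mulmxA Pi2 dotvC.
  have := dotv_ge0 (z - p).
  rewrite !(dotvDl, dotvDr, dotvNl, dotvNr) (dotvC p z); lra.
have eq : dotv e q <= n%:R * lambda * l1norm (D *m v).
  rewrite /q -mulmxA dotv_mulmxr; apply: dotv_le_l1norm => j.
  have := hB j; congr (`|_| <= _); rewrite dotvE mxE.
  by apply: eq_bigr => i _; rewrite !mxE.
have first := tv_first_order theta n0 lambda0 hth.
have decomp := l1norm_decomposability T (D *m th) (D *m theta).
rewrite -mulmxBr thv in decomp.
have hq := hK q; rewrite Dq in hq.
(* Only q enters, because D v = D q; this keeps the square ||p||^2 free. *)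
have young : 4 * n%:R * lambda * l1norm (restr T (D *m v)) <=
    dotv q q + (2 * n%:R * lambda * K) ^+ 2.
  apply: (@le_trans _ _ (4 * n%:R * lambda * (K * l2norm q))).
    by rewrite ler_wpM2l// !mulr_ge0// ltW.
  rewrite -l2norm_sq -subr_ge0.
  rewrite (_ : _ - _ = (l2norm q - 2 * n%:R * lambda * K) ^+ 2); last by ring.
  exact: sqr_ge0.
(* Polarisation produces the term - ||v||^2 that pays for both squares. *)
have polar : 2 * dotv (th - thetastar) v = dotv (th - thetastar) (th - thetastar)
   + dotv v v - dotv (theta - thetastar) (theta - thetastar).
  have -> : theta - thetastar = (th - thetastar) - v.
    by rewrite -thv opprB addrCA addrAC subrr add0r.
  move: (th - thetastar) => w.
  by rewrite !(dotvDl, dotvDr, dotvNl, dotvNr) (dotvC v w); ring.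
rewrite (_ : th - (thetastar + e) = (th - thetastar) - e) in first; last first.
  by rewrite opprD addrA.
rewrite thv dotvDl dotvNl [in X in _ - X]vE dotvDr in first.
rewrite !l2norm_sq.
have decomp' := ler_wpM2l (mulr_ge0 (ltW nR) lambda0) decomp.
rewrite -(ler_pM2l nR) !mulrDr !mulVKf ?gt_eqF// (mulrC nu) mulVKf ?gt_eqF//.
rewrite (_ : n%:R * (4 * n%:R * _ * _) = (2 * n%:R * lambda * K) ^+ 2);
  last by ring.
move: first decomp' young polar ep eq; rewrite vv; lra.
Qed.

End Vectors.

(** * Expectations of products of independent variables *)

Section WeightedIntegral.
Import HBNNSimple.

Section OneMeasure.
Context d d' (T : measurableType d) (U : measurableType d') (R : realType).
Local Open Scope ereal_scope.

Lemma weighted_integral_simple (mu : {measure set T -> \bar R}) (X : T -> U)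
    (g : T -> R) (f : {nnsfun U >-> R}) :
  measurable_fun setT X -> measurable_fun setT g -> (forall x, 0 <= g x)%R ->
  \int[mu]_x (g x * f (X x))%:E =
  \sum_(y \in range f) y%:E * \int[mu]_x (g x * \1_(f @^-1` [set y]) (X x))%:E.
Proof.
move=> mX mg g0.
have mind y : measurable_fun setT (fun x => g x * \1_(f @^-1` [set y]) (X x))%R.
  apply: measurable_funM => //.
  by apply: measurableT_comp => //; exact: measurable_indic.
under eq_integral => x _.
  rewrite fimfunE mulr_fsumr -fsumEFin//.
  under eq_fsbigr do rewrite mulrCA.
  over.
rewrite ge0_integral_fsum//; last 2 first.
- by move=> y; apply/measurable_EFinP; exact: measurable_funM.
- move=> y x _; rewrite mulrCA lee_fin mulr_ge0//.
  exact: nnfun_muleindic_ge0.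
apply: eq_fsbigr => y /set_mem[x _ <-].
under eq_integral do rewrite EFinM.
rewrite ge0_integralZl_EFin//.
- by move=> z _; rewrite lee_fin mulr_ge0.
- exact/measurable_EFinP.
Qed.

Lemma weighted_integral_lim (mu : {measure set T -> \bar R}) (X : T -> U)
    (g : T -> R) (f : U -> R) (mf : measurable_fun setT (EFin \o f)) :
  measurable_fun setT X -> measurable_fun setT g -> (forall x, 0 <= g x)%R ->
  (forall x, 0 <= f x)%R ->
  \int[mu]_x (g x * f (X x))%:E =
  limn (fun n => \int[mu]_x (g x * nnsfun_approx measurableT mf n (X x))%:E).
Proof.
move=> mX mg g0 f0; pose f_ := nnsfun_approx measurableT mf.
rewrite -monotone_convergence//.
- apply: eq_integral => x _; apply/esym/cvg_lim => //.
  have : (EFin \o f_ ^~ (X x)) @ \oo --> (f (X x))%:E.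
    by apply: cvg_nnsfun_approx => // y _; rewrite lee_fin.
  by rewrite EFinM; exact: cvgeZl.
- move=> n; apply/measurable_EFinP/measurable_funM => //.
  exact: measurableT_comp.
- by move=> n x _; rewrite lee_fin mulr_ge0.
- move=> x _ m n mn; rewrite lee_fin ler_wpM2l//.
  exact/lefP/nd_nnsfun_approx.
Qed.

End OneMeasure.

(** If the images under X1 and X2 of the measures with densities g1 and g2 agree
    on measurable sets, they have the same integrals.  Phrasing this with weights
    inside the integrals avoids constructing the weighted measures; X1 and X2
    may moreover live on different spaces. *)
Lemma weighted_integral_eq (R : realType) d1 d2 d (T1 : measurableType d1)
    (T2 : measurableType d2) (U : measurableType d)
    (mu1 : {measure set T1 -> \bar R}) (mu2 : {measure set T2 -> \bar R})
    (X1 : T1 -> U) (X2 : T2 -> U) (g1 : T1 -> R) (g2 : T2 -> R) (f : U -> R) :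
  measurable_fun setT X1 -> measurable_fun setT X2 ->
  measurable_fun setT g1 -> measurable_fun setT g2 -> measurable_fun setT f ->
  (forall x, 0 <= g1 x) -> (forall x, 0 <= g2 x) -> (forall x, 0 <= f x) ->
  (forall B, measurable B -> \int[mu1]_x (g1 x * \1_B (X1 x))%:E =
                             \int[mu2]_x (g2 x * \1_B (X2 x))%:E)%E ->
  (\int[mu1]_x (g1 x * f (X1 x))%:E = \int[mu2]_x (g2 x * f (X2 x))%:E)%E.
Proof.
move=> mX1 mX2 mg1 mg2 mf g10 g20 f0 eqB.
have mEf : measurable_fun setT (EFin \o f) by exact/measurable_EFinP.
rewrite (weighted_integral_lim _ mEf)// (weighted_integral_lim _ mEf)//.
apply: (congr1 (fun u : nat -> \bar R => limn u)); apply/funext => n.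
rewrite !weighted_integral_simple//; apply: eq_fsbigr => y _.
by rewrite eqB.
Qed.

End WeightedIntegral.

Lemma preimage_RV_measurable (R : realType) d (Omega : measurableType d)
    (P : probability Omega R) (X : {RV P >-> R}) (B : set R) :
  measurable B -> measurable (X @^-1` B).
Proof. by move=> mB; exact: measurable_funPTI. Qed.

Lemma integral_indic_comp (R : realType) d (Omega : measurableType d)
    (P : probability Omega R) (X : {RV P >-> R}) (B : set R) :
  measurable B -> (\int[P]_w (\1_B (X w))%:E = P (X @^-1` B))%E.
Proof.
move=> mB; rewrite -[X in P X]setTI setIC -integral_indic//.
exact: preimage_RV_measurable.
Qed.

(** The change-of-density formula is the comparison of the law of X, with weight
    1, with the Lebesgue measure, weighted by the normal density. *)
Lemma integral_gaussian (R : realType) d (Omega : measurableType d)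
    (P : probability Omega R) (X : {RV P >-> R}) (mean sd : R) (f : R -> R) :
  (forall B, measurable B -> distribution P X B = normal_prob mean sd B) ->
  measurable_fun setT f -> (forall x, 0 <= f x) ->
  (\int[P]_w (f (X w))%:E =
   \int[lebesgue_measure]_x (normal_pdf mean sd x * f x)%:E)%E.
Proof.
move=> law mf f0.
have /= := @weighted_integral_eq R _ _ _ Omega (measurableTypeR R) R
  P lebesgue_measure X id (cst 1) (normal_pdf mean sd) f.
under eq_integral do rewrite mul1r.
apply => //.
- exact: measurable_normal_pdf.
- by move=> x; exact: normal_pdf_ge0.
- move=> B mB; under eq_integral do rewrite mul1r.
  rewrite integral_indic_comp// -[LHS]/(distribution P X B) law//.
  rewrite /normal_prob [LHS]integral_mkcond.
  apply: eq_integral => x _; rewrite /patch indicE.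
  by case: ifPn => _; rewrite ?mulr1 ?mulr0.
Qed.

(** Completing the square: exp (r x) times the density of N(0, sigma^2) is
    exp (r^2 sigma^2 / 2) times the density of N(r sigma^2, sigma^2). *)
Lemma gaussian_mgf (R : realType) d (Omega : measurableType d)
    (P : probability Omega R) (X : {RV P >-> R}) (sigma r : R) :
  sigma != 0 ->
  (forall B, measurable B -> distribution P X B = normal_prob 0 sigma B) ->
  (\int[P]_w (expR (r * X w))%:E = (expR (r ^+ 2 * sigma ^+ 2 / 2))%:E)%E.
Proof.
move=> s0 law; rewrite (integral_gaussian (f := fun x => expR (r * x)) law)//;
  last first.
- exact: (measurableT_comp (@measurable_expR R) (mulrl_measurable r)).
rewrite (_ : (fun x => _) = (fun x => (expR (r ^+ 2 * sigma ^+ 2 / 2))%:E *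
    (normal_pdf (r * sigma ^+ 2) sigma x)%:E)%E); last first.
  apply/funext => x; rewrite -EFinM; congr (_%:E).
  rewrite !normal_pdfE//= -[LHS]mulrA [RHS]mulrCA; congr (_ * _).
  rewrite /normal_fun -!expRD; congr expR.
  by field.
rewrite ge0_integralZl_EFin//.
- by rewrite integral_normal_pdf mule1.
- by move=> x _; rewrite lee_fin normal_pdf_ge0.
- by apply/measurable_EFinP; exact: measurable_normal_pdf.
Qed.

(** Induction on the list [s] of the variables whose function is not an
    indicator.  With no such variable this is independence itself.  To add the
    variable k, fix the other factors: as functions of the event B, the
    expectation of their product with 1_B(X_k) and the multiple of P (X_k in B)
    by the product of the other expectations agree by the induction hypothesis,
    so B may be replaced by a function.  Taking the expectations [C i] finite
    keeps all weights real. *)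
Lemma independent_integral_prod (R : realType) d (Omega : measurableType d)
    (P : probability Omega R) (n : nat) (X : 'I_n -> {RV P >-> R})
    (s : seq 'I_n) (f : 'I_n -> R -> R) (C : 'I_n -> R) :
  mutually_independent X ->
  (forall i, measurable_fun setT (f i)) -> (forall i x, 0 <= f i x) ->
  (forall i, i \notin s -> exists2 B, measurable B & f i = \1_B) ->
  (forall i, \int[P]_w (f i (X i w))%:E = (C i)%:E)%E ->
  (\int[P]_w (\prod_i f i (X i w))%:E = (\prod_i C i)%:E)%E.
Proof.
move=> indep; elim: s f C => [|k s IH] f C mf f0 find fC.
  have /choice[B] : forall i, exists B, measurable B /\ f i = \1_B.
    by move=> i; have [B] := find i isT; exists B.
  move=> /all_and2[mB fB].
  have <- : P [set w | forall i, i \in [set: 'I_n]%SET -> B i (X i w)] =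
      (\prod_i C i)%:E.
    rewrite indep// -prodEFin.
    by apply: eq_big => [i|i _]; rewrite ?inE// -fC fB integral_indic_comp.
  rewrite -[X in P X]setTI setIC -integral_indic//; last first.
    rewrite (_ : [set _ | _] = \bigcap_(i in [set: 'I_n]) (X i @^-1` B i)).
      by apply: fin_bigcap_measurable => // i _; exact: preimage_RV_measurable.
    by apply/seteqP; split => [w h i _ /=|w h i _]; apply: h => //; rewrite inE.
  apply: eq_integral => w _; congr (_%:E).
  rewrite indicE; have [h|h] := pselect (forall i, B i (X i w)).
    rewrite mem_set//= big1// => i _.
    by rewrite fB indicE mem_set.
  rewrite memNset /=; last by apply: contra_not h => h i; apply: h; rewrite inE.
  have /existsNP[i Bi] := h.
  by rewrite (bigD1 i)//= fB indicE memNset// mul0r.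
pose g w := \prod_(i | i != k) f i (X i w).
pose c := \prod_(i | i != k) C i.
have C0 i : 0 <= C i.
  by rewrite -lee_fin -fC integral_ge0// => w _; rewrite lee_fin.
have mfX i : measurable_fun setT (fun w => f i (X i w)).
  exact: measurableT_comp.
transitivity (\int[P]_w (g w * f k (X k w))%:E)%E.
  by apply: eq_integral => w _; rewrite (bigD1 k)//= mulrC.
rewrite (bigD1 k)//= -/c.
transitivity (\int[P]_w (cst c w * f k (X k w))%:E)%E; last first.
  under eq_integral do rewrite EFinM.
  rewrite ge0_integralZl_EFin ?fC ?EFinM//= 1?muleC//.
  - by move=> w _; rewrite lee_fin.
  - exact/measurable_EFinP.
  - by apply: prodr_ge0.
apply: weighted_integral_eq => //.
- rewrite /g; under eq_fun do rewrite -big_filter.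
  by apply: measurable_prod => i _.
- by move=> w; apply: prodr_ge0 => i _.
- by move=> w; apply: prodr_ge0.
move=> B mB.
pose f' i : R -> R := if i == k then \1_B else f i.
pose C' i := if i == k then fine (P (X k @^-1` B)) else C i.
have finP : P (X k @^-1` B) \is a fin_num.
  by apply: fin_num_measure; exact: preimage_RV_measurable.
have := IH f' C'.
rewrite (bigD1 k)//= {2}/C' eqxx (eq_bigr C) => [|i /negPf]; last first.
  by rewrite /C' => ->.
rewrite -/c => IHB.
transitivity (\int[P]_w (\prod_i f' i (X i w))%:E)%E.
  apply: eq_integral => w _; congr (_%:E).
  rewrite (bigD1 k)//= {1}/f' eqxx mulrC; congr (_ * _).
  by apply: eq_bigr => i /negPf; rewrite /f' => ->.
rewrite IHB.
- rewrite EFinM fineK// -integral_indic_comp//.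
  under [RHS]eq_integral do rewrite EFinM.
  rewrite ge0_integralZl_EFin//= 1?muleC//.
  + by apply/measurable_EFinP; exact: measurableT_comp.
  + by apply: prodr_ge0.
- by rewrite /f' => i; case: ifP => // _; exact: measurable_indic.
- by rewrite /f' => i x; case: ifP.
- move=> i si; rewrite /f'; case: eqVneq => [_|ik]; first by exists B.
  by apply: find; rewrite inE negb_or ik.
- move=> i; rewrite /f' /C'; case: eqVneq => [->|_] //.
  by rewrite fineK ?integral_indic_comp.
Qed.

(** * Gaussian tail bounds *)

Lemma measurable_lincomb (R : realType) d (Omega : measurableType d)
    (P : probability Omega R) (n : nat) (X : 'I_n -> {RV P >-> R})
    (a : 'cV[R]_n) : measurable_fun setT (fun w => dotv a (\col_i X i w)).
Proof.
under eq_fun => w do (rewrite dotvE; under eq_bigr do rewrite mxE).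
by apply: measurable_sum => i; exact: measurable_funM.
Qed.

Lemma measurable_superlevel (R : realType) d (Omega : measurableType d)
    (f : Omega -> R) (t : R) :
  measurable_fun setT f -> measurable [set w | t < f w].
Proof.
move=> mf; rewrite (_ : [set _ | _] = setT `&` f @^-1` `]t, +oo[%classic).
  exact: mf.
by rewrite setTI; apply/seteqP; split => w /=; rewrite in_itv/= andbT.
Qed.

Lemma gaussian_lincomb_mgf (R : realType) d (Omega : measurableType d)
    (P : probability Omega R) (n : nat) (sigma : R) (X : 'I_n -> {RV P >-> R})
    (a : 'cV[R]_n) (r : R) :
  0 < sigma -> gaussian_noise sigma X ->
  (\int[P]_w (expR (r * dotv a (\col_i X i w)))%:E =
   (expR (r ^+ 2 * sigma ^+ 2 * l2norm a ^+ 2 / 2))%:E)%E.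
Proof.
move=> sigma0 [indep law].
pose f i x : R := expR (r * a i 0 * x).
pose C i : R := expR ((r * a i 0) ^+ 2 * sigma ^+ 2 / 2).
have mf i : measurable_fun setT (f i).
  exact: (measurableT_comp (@measurable_expR R) (mulrl_measurable (r * a i 0))).
transitivity (\int[P]_w (\prod_i f i (X i w))%:E)%E.
  apply: eq_integral => w _; congr (_%:E).
  rewrite -expR_sum dotvE mulr_sumr; congr expR.
  by apply: eq_bigr => i _; rewrite mxE mulrA.
rewrite (@independent_integral_prod _ _ _ _ _ X (enum 'I_n) f C)//.
- rewrite -expR_sum l2norm_sq dotvE mulr_sumr mulr_suml; congr (expR _)%:E.
  by apply: eq_bigr => i _; ring.
- by move=> i x; exact: expR_ge0.
- by move=> i; rewrite mem_enum.
- by move=> i; apply: gaussian_mgf; [rewrite gt_eqF | exact: law].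
Qed.

(** Chernoff's bound at the optimal slope r = sqrt (2 u) / (sigma b).  The
    inequality in the event is strict so that the degenerate case b = 0, in which
    the linear combination vanishes, is covered as well. *)
Lemma gaussian_lincomb_upper_tail (R : realType) d (Omega : measurableType d)
    (P : probability Omega R) (n : nat) (sigma : R) (X : 'I_n -> {RV P >-> R})
    (a : 'cV[R]_n) (b u : R) :
  0 < sigma -> gaussian_noise sigma X -> l2norm a <= b -> 0 < u ->
  (P [set w | (sigma * b * Num.sqrt (2 * u) < dotv a (\col_i X i w))%R]
    <= (expR (- u))%:E)%E.
Proof.
move=> sigma0 hX ab u0.
have b0 : 0 <= b by apply: le_trans ab; exact: l2norm_ge0.
have [b00|bneq0] := eqVneq b 0.
  rewrite (_ : [set _ | _] = set0) ?measure0 ?lee_fin ?expR_ge0//.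
  apply/seteqP; split => // w /=.
  rewrite b00 mulr0 mul0r dotvE big1 ?ltxx// => i _.
  have : `|a i 0| <= 0 by rewrite -b00 (le_trans (coord_le_l2norm a i)).
  by rewrite normr_le0 => /eqP ->; rewrite mul0r.
have bgt0 : 0 < b by rewrite lt_neqAle eq_sym bneq0.
pose v := Num.sqrt (2 * u).
have v2 : v ^+ 2 = 2 * u by rewrite sqr_sqrtr// mulr_ge0// ltW.
have v0 : 0 < v by rewrite sqrtr_gt0 mulr_gt0.
have [r r0 rs] : exists2 r, 0 < r & r * sigma * b = v.
  exists (v / (sigma * b)); first by rewrite divr_gt0// mulr_gt0.
  by field; rewrite !gt_eqF.
pose Y : {RV P >-> R} := HB.pack_for {mfun Omega >-> R}
  (fun w => dotv a (\col_i X i w))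
  (isMeasurableFun.Build _ _ _ _ _ (measurable_lincomb X a)).
apply: (@le_trans _ _ (P [set w | (sigma * b * v <= Y w)%R])).
  apply: le_measure; rewrite ?inE.
  - exact/measurable_superlevel/measurable_lincomb.
  - rewrite (_ : [set _ | _] = Y @^-1` `[sigma * b * v, +oo[%classic).
      exact: preimage_RV_measurable.
    by apply/seteqP; split => w /=; rewrite in_itv/= andbT.
  - by move=> w /ltW.
apply: le_trans (chernoff Y _ r0) _.
rewrite /mmt_gen_fun unlock.
under eq_integral do rewrite /= mulrC.
rewrite (gaussian_lincomb_mgf a r sigma0 hX) -EFinM lee_fin -expRD ler_expR.
have ab2 : l2norm a ^+ 2 <= b ^+ 2 by rewrite lerXn2r// nnegrE l2norm_ge0.
have := ler_wpM2l (mulr_ge0 (sqr_ge0 r) (sqr_ge0 sigma)) ab2.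
have -> : r ^+ 2 * sigma ^+ 2 * b ^+ 2 = 2 * u by rewrite -v2 -rs; ring.
have -> : r * (sigma * b * v) = 2 * u by rewrite -v2 -[in RHS]rs -[in LHS]rs; ring.
lra.
Qed.

Lemma gaussian_lincomb_tail (R : realType) d (Omega : measurableType d)
    (P : probability Omega R) (n : nat) (sigma : R) (X : 'I_n -> {RV P >-> R})
    (a : 'cV[R]_n) (b u : R) :
  0 < sigma -> gaussian_noise sigma X -> l2norm a <= b -> 0 < u ->
  (P [set w | (sigma * b * Num.sqrt (2 * u) < `|dotv a (\col_i X i w)|)%R]
    <= (2 * expR (- u))%:E)%E.
Proof.
move=> sigma0 hX ab u0; set t := sigma * b * _.
have normN : l2norm (- a) = l2norm a.
  by rewrite /l2norm; under eq_bigr do rewrite mxE sqrrN.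
rewrite (_ : [set _ | _] = [set w | t < dotv a (\col_i X i w)] `|`
                           [set w | t < dotv (- a) (\col_i X i w)]).
  rewrite mulr_natl mulr2n EFinD.
  apply: (le_trans (measureU2 _ _ _)).
  - exact/measurable_superlevel/measurable_lincomb.
  - exact/measurable_superlevel/measurable_lincomb.
  - by apply: leeD; apply: gaussian_lincomb_upper_tail; rewrite ?normN.
by apply/seteqP; split => w /=; rewrite dotvNl ltr_normr => /orP.
Qed.

Lemma union_bound (R : realType) d (Omega : measurableType d)
    (P : probability Omega R) (I : Type) (s : seq I) (A : I -> set Omega)
    (p : R) :
  (forall i, measurable (A i)) -> (forall i, (P (A i) <= p%:E)%E) ->
  measurable (\big[setU/set0]_(i <- s) A i) /\
  (P (\big[setU/set0]_(i <- s) A i) <= ((size s)%:R * p)%:E)%E.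
Proof.
move=> mA pA; elim: s => [|i s [mU pU]].
  by rewrite !big_nil measure0 mul0r.
rewrite !big_cons; split; first exact: measurableU.
apply: (le_trans (measureU2 _ _ _)) => //.
by rewrite /= -nat1r mulrDl mul1r EFinD leeD.
Qed.

(** * Incidence matrices of connected graphs *)

Section Incidence.
Context {R : realType} (n m : nat) (g : rel 'I_n) (ed : 'I_m -> 'I_n * 'I_n).
Hypothesis girr : irreflexive g.
Hypothesis gconn : forall i j, connect g i j.
Hypothesis hed : edge_labelling g ed.
Let D : 'M[R]_(m, n) := incidence R ed.

(** Which endpoint carries the entry 1 depends on the numbering of the
    vertices, and the order in which the labelling lists the two is arbitrary;
    the absolute value is insensitive to both. *)
Lemma incidence_mulmx (theta : 'cV[R]_n) e :
  `|(D *m theta) e 0| = `|theta (ed e).1 0 - theta (ed e).2 0|.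
Proof.
have : (ed e).1 != (ed e).2.
  by apply/eqP => ee; have := hed.1 e; rewrite ee girr.
have sumE (a b : 'I_n) : a != b ->
    \sum_(k < n) (if k == a :> nat then 1 else if k == b :> nat then -1 else 0) *
       theta k 0 = theta a 0 - theta b 0.
  move=> ab; rewrite (bigD1 a)//= (bigD1 b) ?(eq_sym b)//= !eqxx mul1r.
  rewrite ifN ?mulN1r; last by rewrite eq_sym.
  rewrite big1 ?addr0// => k /andP[ka kb].
  by rewrite !ifN ?mul0r.
rewrite mxE; under eq_bigr do rewrite mxE.
case: (ed e) => a b /= ab.
have [ltab|ltba|/val_inj] := ltngtP a b.
- by rewrite sumE.
- by rewrite sumE 1?eq_sym// distrC.
- by move/eqP; rewrite (negPf ab).
Qed.

(** The level set of theta through i is closed under adjacency, hence contains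
    every vertex of a connected graph. *)
Lemma incidence_ker_const (theta : 'cV[R]_n) i j :
  D *m theta = 0 -> theta i 0 = theta j 0.
Proof.
move=> Dt0.
have cl : fingraph.closed g [pred k | theta k 0 == theta i 0].
  move=> x y gxy; rewrite !inE.
  have [e [exy _]] := hed.2 x y gxy.
  have := incidence_mulmx theta e; rewrite Dt0 mxE normr0 => /esym/eqP.
  by rewrite normr_eq0 subr_eq0 => /eqP; case: exy => -> /= ->.
by have := closed_connect cl (gconn i j); rewrite !inE eqxx => /esym/eqP ->.
Qed.

Lemma edges_gt0 : (2 <= n)%N -> (0 < m)%N.
Proof.
move=> n2; pose i := Ordinal (ltnW n2); pose j := Ordinal n2.
have /connectP[[|x p] /=] := gconn i j.
  by move=> _ /(congr1 val).
by move=> /andP[/hed.2[e _]] _ _; apply: leq_ltn_trans (ltn_ord e).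
Qed.

End Incidence.

(** The columns of the projection Pi = 1 - B D lie in ker D, so they are
    constant, and by symmetry all entries of Pi equal one number c.  Idempotence
    reads n c^2 = c, which leaves c = 0 or c = 1 / n. *)
Lemma dotv_ker_proj_le (R : realType) m n (D : 'M[R]_(m, n)) B (e : 'cV[R]_n) :
  (0 < n)%N -> moore_penrose D B ->
  (forall (v : 'cV[R]_n) i j, D *m v = 0 -> v i 0 = v j 0) ->
  dotv e ((1%:M - B *m D) *m e) <= dotv (const_mx 1) e ^+ 2 / n%:R.
Proof.
move=> n0 [DBD BDB _ BDsym] kerD.
pose Pi := 1%:M - B *m D; rewrite -/Pi.
have PiT : Pi^T = Pi by rewrite linearB/= trmx1 BDsym.
have Pi2 : Pi *m Pi = Pi.
  by rewrite /Pi mulmxBr mulmx1 mulmxBl mul1mx [_ *m (B *m D)]mulmxA BDB subrr subr0.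
have DPi : D *m Pi = 0 by rewrite /Pi mulmxBr mulmx1 mulmxA DBD subrr.
pose i0 := Ordinal n0; pose c := Pi i0 i0.
have colc i i' j : Pi i j = Pi i' j.
  have := kerD (col j Pi) i i'; rewrite ![col _ _ _ _]mxE; apply.
  by rewrite colE mulmxA DPi mul0mx.
have Pic i j : Pi i j = c.
  by rewrite (colc i i0) -PiT mxE (colc j i0).
have nR : 0 < n%:R :> R by rewrite ltr0n.
have nc : n%:R * c ^+ 2 = c.
  rewrite -{2}(Pic i0 i0) -Pi2 mxE; under eq_bigr do rewrite !Pic.
  by rewrite sumr_const card_ord mulr_natl expr2.
have -> : dotv e (Pi *m e) = c * dotv (const_mx 1) e ^+ 2.
  rewrite dotvE dotvE expr2 mulr_suml mulr_sumr.
  apply: eq_bigr => i _; rewrite mxE; under eq_bigr do rewrite Pic.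
  rewrite -mulr_sumr !mxE mul1r mulrCA; congr (c * (_ * _)).
  by apply: eq_bigr => j _; rewrite mxE mul1r.
rewrite mulrC ler_wpM2l ?sqr_ge0//.
have [->|c0] := eqVneq c 0; first by rewrite invr_ge0 ltW.
rewrite -[leRHS]mul1r ler_pdivlMr//.
have : c * (n%:R * c - 1) = 0 by rewrite mulrBr mulr1 mulrCA -expr2 nc subrr.
by move=> /eqP; rewrite mulf_eq0 (negPf c0) subr_eq0 mulrC => /eqP ->.
Qed.

Lemma const_mx_l2norm (R : realType) n :
  l2norm (const_mx 1 : 'cV[R]_n) = Num.sqrt n%:R.
Proof.
rewrite /l2norm; under eq_bigr do rewrite mxE expr1n.
by rewrite sumr_const card_ord.
Qed.

Lemma col_mpinv_le_inverse_scaling (R : realType) m n (D : 'M[R]_(m, n)) j :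
  l2norm (col j (mpinv D)) <= inverse_scaling D.
Proof. exact: le_bigmax. Qed.

(** * The oracle inequality *)

Theorem theorem2 (R : realType) (n m : nat) (hn : (2 <= n)%N)
  (g : rel 'I_n) (gsym : symmetric g) (girr : irreflexive g)
  (gconn : forall i j, connect g i j)
  (ed : 'I_m -> 'I_n * 'I_n) (hed : edge_labelling g ed)
  (d : measure_display) (Omega : measurableType d) (P : probability Omega R)
  (sigma : R) (hsigma : 0 < sigma)
  (eps : 'I_n -> {RV P >-> R}) (heps : gaussian_noise sigma eps)
  (thetastar : 'cV[R]_n)
  (delta : R) (hdelta : 0 < delta < 1)
  (T : {set 'I_m}) :
  let D := incidence R ed in
  let y (w : Omega) := thetastar + \col_i eps i w in
  let rho := inverse_scaling D in
  let kappa := compatibility D T in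
  let L := ln (expR 1 * m%:R / delta) in
  let lambda := n%:R^-1 * sigma * rho * Num.sqrt (2 * L) in
  forall thetahat : Omega -> 'cV[R]_n,
  (forall w, tv_denoiser D lambda (y w) (thetahat w)) ->
  with_prob_ge P (1 - 2 * delta)
    [set w | n%:R^-1 * l2norm (thetahat w - thetastar) ^+ 2 <=
       inf (range (fun thetabar : 'cV[R]_n =>
         n%:R^-1 * l2norm (thetabar - thetastar) ^+ 2
         + 4 * lambda * l1norm (restr (~: T) (D *m thetabar))))
       + 8 * sigma ^+ 2 / n%:R *
         (#|T|%:R * rho ^+ 2 / kappa ^+ 2 * L + ln (expR 1 / delta))].
Proof.
move=> D y rho kappa L lambda thetahat hth.
have m0 : (0 < m)%N by exact: (edges_gt0 gconn hed).
have n0 : (0 < n)%N by exact: ltnW.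
have nR : 0 < n%:R :> R by rewrite ltr0n.
have mR : 1 <= m%:R :> R by rewrite ler1n.
have [d0 d1] := andP hdelta.
have e2 : 2 <= expR 1 :> R by have := expR_ge1Dx (1 : R); lra.
pose l := ln (expR 1 / delta).
have l0 : 0 < l by apply: ln_gt0; rewrite ltr_pdivlMr//; lra.
have em2 : 2 <= expR 1 * m%:R :> R.
  by apply: le_trans e2 _; apply: ler_peMr => //; lra.
have L0 : 0 < L by apply: ln_gt0; rewrite ltr_pdivlMr//; lra.
have expL : expR (- L) = delta / (expR 1 * m%:R).
  by rewrite expRN lnK ?invf_div// posrE divr_gt0//; lra.
have expl : expR (- l) = delta / expR 1.
  by rewrite expRN lnK ?invf_div// posrE divr_gt0//; lra.
have rho0 : 0 <= rho.
  exact: le_trans (l2norm_ge0 _) (col_mpinv_le_inverse_scaling D (Ordinal m0)).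
have lambda0 : 0 <= lambda.
  by rewrite !mulr_ge0 ?sqrtr_ge0 ?invr_ge0// ltW.
have nlambda : n%:R * lambda = sigma * rho * Num.sqrt (2 * L).
  by rewrite /lambda !mulrA divff ?mul1r// gt_eqF.
pose e w : 'cV[R]_n := \col_i eps i w.
(* Outside of the bad events, n lambda bounds every <s_j, eps>, and [t] bounds
   the sum of the noise coordinates. *)
pose bad j := [set w | n%:R * lambda < `|dotv (col j (mpinv D)) (e w)|].
pose t := sigma * Num.sqrt n%:R * Num.sqrt (2 * l).
pose bad1 := [set w | t < `|dotv (const_mx 1) (e w)|].
have mbad v s : measurable [set w | s < `|dotv v (e w)|].
  apply: measurable_superlevel.
  exact: (measurableT_comp (@normr_measurable R setT) (measurable_lincomb eps v)).
have Pbad j : (P (bad j) <= (2 * (delta / (expR 1 * m%:R)))%:E)%E.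
  rewrite /bad nlambda -expL; apply: gaussian_lincomb_tail => //.
  exact: col_mpinv_le_inverse_scaling.
have [mU PU] := union_bound (index_enum 'I_m) (fun j => mbad _ _) Pbad.
have Pbad1 : (P bad1 <= (2 * (delta / expR 1))%:E)%E.
  rewrite -expl; apply: gaussian_lincomb_tail => //.
  by rewrite const_mx_l2norm.
set U := \big[setU/set0]_(i <- _) _ in mU PU.
exists (~` (U `|` bad1)).
have mUb : measurable (U `|` bad1) by apply: measurableU => //; exact: mbad.
split; first exact: measurableC.
- move=> w /= /not_orP[nU nbad1].
  have hA : dotv (e w) ((1%:M - mpinv D *m D) *m e w) <= 2 * sigma ^+ 2 * l.
    apply: le_trans (dotv_ker_proj_le _ n0 (mpinvP D) _) _.
      by move=> v i j; exact: (incidence_ker_const girr gconn hed).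
    rewrite ler_pdivrMr// -(real_normK (num_real _)).
    have /negP := nbad1; rewrite -leNgt => h.
    apply: (@le_trans _ _ (t ^+ 2)).
      by rewrite lerXn2r// nnegrE// !mulr_ge0 ?sqrtr_ge0// ltW.
    have t2 : t ^+ 2 = 2 * sigma ^+ 2 * l * n%:R.
      rewrite /t !exprMn !sqr_sqrtr ?mulr_ge0 ?(ltW nR) ?(ltW l0)//; ring.
    by rewrite t2.
  have hB j : `|dotv (col j (mpinv D)) (e w)| <= n%:R * lambda.
    rewrite leNgt; apply/negP => hj; apply: nU.
    by rewrite /U (bigD1 j)//=; left.
  have oracle theta := tv_oracle_inequality theta n0 lambda0 (mpinvP D)
    (compatibility_bound D T) hB hA (hth w).
  set X := n%:R^-1 * _; set C := 8 * _ / _ * _.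
  rewrite -lerBlDr; apply: lb_le_inf.
    by eexists; exists 0.
  move=> _ [theta _ <-]; rewrite lerBlDr.
  apply: le_trans (oracle theta) _; rewrite lerD2l.
  have K2 : (Num.sqrt #|T|%:R / kappa) ^+ 2 = #|T|%:R / kappa ^+ 2.
    by rewrite expr_div_n sqr_sqrtr.
  rewrite -/D -/kappa K2.
  have -> : 4 * n%:R * lambda ^+ 2 * (#|T|%:R / kappa ^+ 2) =
      8 * sigma ^+ 2 / n%:R * (#|T|%:R * rho ^+ 2 / kappa ^+ 2 * L).
    rewrite /lambda !exprMn sqr_sqrtr ?mulr_ge0 ?ltW//.
    move: (kappa ^+ 2)^-1 => k.
    by field; rewrite gt_eqF.
  rewrite /C mulrDr addrC lerD2l -/l.
  rewrite [leRHS]mulrAC; apply: ler_wpM2r; first by rewrite invr_ge0 ltW.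
  apply: ler_wpM2r; first exact: ltW.
  by have := sqr_ge0 sigma; lra.
- rewrite probability_setC// EFinB leeB//.
  apply: (le_trans (measureU2 _ _ _)) => //; first exact: mbad.
  apply: le_trans (leeD PU Pbad1) _.
  rewrite -EFinD lee_fin [size _](_ : _ = m); last first.
    by rewrite [index_enum _]unlock -enumT size_enum_ord.
  (* m * (2 delta / (e m)) + 2 delta / e, and e >= 2 *)
  rewrite (_ : _ + _ = 4 * delta / expR 1); last first.
    by field; rewrite !gt_eqF ?expR_gt0//; lra.
  by rewrite ler_pdivrMr ?expR_gt0//; nra.
Qed.
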